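(* Let $(u^n)_{0\le n\le N_t}\subset\mathcal Z_h$, together with intermediate grid functions $u^{n,s}\in\mathcal Z_h$, $s=1,\dots,5$, satisfy for every $0\le n\le N_t-1$ and all $i,j$ the Strang-ADI-HOC difference scheme $$\mathcal H_{1x}\mathcal A_yu^{n,1}_{i,j}=\Big(\mathcal A_x\mathcal A_y+\tfrac{\nu\tau}{4}\mathcal A_y\delta_x^2+\tfrac{\nu\tau}{2}\mathcal A_x\delta_y^2\Big)u^n_{i,j},$$ $$\mathcal H_{1y}u^{n,2}_{i,j}=\mathcal A_yu^{n,1}_{i,j}-\tfrac{\nu\tau}{4}\delta_y^2u^n_{i,j},$$ $$\mathcal B_x\mathcal B_yu^{n,3}_{i,j}=\mathcal B_x\mathcal B_yu^{n,2}_{i,j}-\tau\mathcal B_yD_{\hat x}f^{n,2}_{i,j}-\tau\mathcal B_xD_{\hat y}g^{n,2}_{i,j}+\tau\mathcal B_x\mathcal B_yS^n_{i,j},$$ $$\mathcal B_x\mathcal B_yu^{n,4}_{i,j}=\mathcal B_x\mathcal B_yu^{n,2}_{i,j}-\tfrac{\tau}{2}\mathcal B_yD_{\hat x}(f^{n,2}_{i,j}+f^{n,3}_{i,j})-\tfrac{\tau}{2}\mathcal B_xD_{\hat y}(g^{n,2}_{i,j}+g^{n,3}_{i,j})+\tfrac{\tau}{2}\mathcal B_x\mathcal B_y(S^n_{i,j}+S^{n+1}_{i,j}),$$ $$\mathcal H_{1x}\mathcal A_yu^{n,5}_{i,j}=\Big(\mathcal A_x\mathcal A_y+\tfrac{\nu\tau}{4}\mathcal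 A_y\delta_x^2+\tfrac{\nu\tau}{2}\mathcal A_x\delta_y^2\Big)u^{n,4}_{i,j},$$ $$\mathcal H_{1y}u^{n+1}_{i,j}=\mathcal A_yu^{n,5}_{i,j}-\tfrac{\nu\tau}{4}\delta_y^2u^{n,4}_{i,j}.$$ Then for every $n=0,\dots,N_t-1$, $$(u^{n+1},1)=(u^0,1)+\frac{\tau}{2}\sum_{k=0}^{n}\big(S^k+S^{k+1},1\big).$$
   Context: The scheme discretizes $u_t+f(u)_x+g(u)_y-\nu(u_{xx}+u_{yy})=S(x,y,t)$ on $[0,L]^2\times[0,T]$ with periodic boundary conditions and $\nu>0$; $f,g,S$ are smooth functions, with $S$ being $L$-periodic in $x$ and $y$. Let $N_t$, $N_x,N_y\ge3$ be positive integers, $\tau=T/N_t$, $t^n=n\tau$, $h_x=L/N_x$, $h_y=L/N_y$, $x_i=ih_x$, $y_j=jh_y$. $\mathcal Z_h$ is the space of periodic grid functions $v=\{v_{i,j}\}$, $v_{i+N_x,j}=v_{i,j}=v_{i,j+N_y}$. In the $x$-direction (acting on the index $i$ with $j$ fixed): $$D_{\hat x}v_{i,j}=\frac{v_{i+1,j}-v_{i-1,j}}{2h_x},\quad \delta_x^2v_{i,j}=\frac{v_{i+1,j}-2v_{i,j}+v_{i-1,j}}{h_x^2},$$ $$\mathcal A_xv_{i,j}=\tfrac1{12}(v_{i-1,j}+10v_{i,j}+v_{i+1,j}),\quad \mathcal B_xv_{i,j}=\tfrac16(v_{i-1,j}+4v_{i,j}+v_{i+1,j}),\quad \mathcal H_{1x}=\mathcal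 A_x-\tfrac{\tau}{4}\nu\delta_x^2,$$ and $D_{\hat y},\delta_y^2,\mathcal A_y,\mathcal B_y,\mathcal H_{1y}$ are defined in the same way in the index $j$ with $h_y$. Here $f^{n,s}_{i,j}=f(u^{n,s}_{i,j})$, $g^{n,s}_{i,j}=g(u^{n,s}_{i,j})$, $S^k_{i,j}=S(x_i,y_j,t^k)$. The discrete inner product is $(w,v)=\sum_{i=1}^{N_x}\sum_{j=1}^{N_y}h_xh_yw_{i,j}v_{i,j}$, and $1$ is the constant grid function. $u^0$ is the grid function of initial values. *)

(* Defs.v *)
From HB Require Import structures.
From mathcomp Require Import all_boot all_order all_algebra.
From mathcomp Require Import all_classical all_reals all_analysis.

Set Implicit Arguments.
Unset Strict Implicit.
Unset Printing Implicit Defensive.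

Import Order.TTheory GRing.Theory Num.Theory.
Import numFieldNormedType.Exports.

Local Open Scope ring_scope.

Section Smooth.
Variables (R : realType) (V : normedModType R).

(* For V of finite dimension this is the usual class C^k. *)
Fixpoint Ck (k : nat) (F : V -> R) : Prop :=
  if k is k'.+1 then
    continuous F /\
    forall v : V, (forall x, derivable F x v) /\ Ck k' (fun x => 'D_v F x)
  else continuous F.

Definition smooth (F : V -> R) : Prop := forall k, Ck k F.

(* The customary meaning of smoothness up to the boundary of a closed domain. *)
Definition smooth_on (D : set V) (F : V -> R) : Prop :=
  exists2 G : V -> R, smooth G & forall x, D x -> F x = G x.

End Smooth.

Section Grid.
Variable R : realType.

Definition grid : Type := int -> int -> R.

Definition periodic_grid (Nx Ny : nat) (v : grid) : Prop :=
  forall i j : int, v (i + Nx%:Z) j = v i j /\ v i (j + Ny%:Z) = v i j.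

Definition inner (hx hy : R) (Nx Ny : nat) (w v : grid) : R :=
  \sum_(1 <= i < Nx.+1) \sum_(1 <= j < Ny.+1)
    hx * hy * w i%:Z j%:Z * v i%:Z j%:Z.

Definition one_grid : grid := fun _ _ => 1.

Definition inx (P : (int -> R) -> int -> R) (v : grid) : grid :=
  fun i j => P (fun k => v k j) i.

Definition iny (P : (int -> R) -> int -> R) (v : grid) : grid :=
  fun i j => P (fun k => v i k) j.

Definition cdiff (h : R) (w : int -> R) (i : int) : R :=
  (w (i + 1) - w (i - 1)) / (2 * h).

Definition delta2 (h : R) (w : int -> R) (i : int) : R :=
  (w (i + 1) - 2 * w i + w (i - 1)) / h ^+ 2.

Definition opA (w : int -> R) (i : int) : R :=
  12^-1 * (w (i - 1) + 10 * w i + w (i + 1)).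

Definition opB (w : int -> R) (i : int) : R :=
  6^-1 * (w (i - 1) + 4 * w i + w (i + 1)).

Definition opH1 (tau nu h : R) (w : int -> R) (i : int) : R :=
  opA w i - tau / 4 * nu * delta2 h w i.

Definition comp_grid (f : R -> R) (v : grid) : grid := fun i j => f (v i j).

Definition add_grid (v w : grid) : grid := fun i j => v i j + w i j.

Definition sample (S : R -> R -> R -> R) (tau hx hy : R) (k : nat) : grid :=
  fun i j => S (i%:~R * hx) (j%:~R * hy) (k%:R * tau).

(* One time step of the scheme: [u] and [u'] are the solution at the old and the
   new time level, [S0] and [S1] the source there, [us s] the stage [s], which
   is used for [s = 1, ..., 5] only. *)
Definition strang_adi_hoc_step (nu tau hx hy : R) (f g : R -> R)
    (S0 S1 : grid) (u : grid) (us : nat -> grid) (u' : grid) : Prop :=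
  let Dx := inx (cdiff hx) in let Dy := iny (cdiff hy) in
  let dx2 := inx (delta2 hx) in let dy2 := iny (delta2 hy) in
  let Ax := inx opA in let Ay := iny opA in
  let Bx := inx opB in let By := iny opB in
  let H1x := inx (opH1 tau nu hx) in let H1y := iny (opH1 tau nu hy) in
  let F := comp_grid f in let G := comp_grid g in
  let rhs v i j := Ax (Ay v) i j + nu * tau / 4 * Ay (dx2 v) i j
                   + nu * tau / 2 * Ax (dy2 v) i j in
  forall i j : int,
  [/\ H1x (Ay (us 1%N)) i j = rhs u i j,
      H1y (us 2%N) i j = Ay (us 1%N) i j - nu * tau / 4 * dy2 u i j,
      Bx (By (us 3%N)) i j = Bx (By (us 2%N)) i j
        - tau * By (Dx (F (us 2%N))) i j
        - tau * Bx (Dy (G (us 2%N))) i j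
        + tau * Bx (By S0) i j,
      Bx (By (us 4%N)) i j = Bx (By (us 2%N)) i j
        - tau / 2 * By (Dx (add_grid (F (us 2%N)) (F (us 3%N)))) i j
        - tau / 2 * Bx (Dy (add_grid (G (us 2%N)) (G (us 3%N)))) i j
        + tau / 2 * Bx (By (add_grid S0 S1)) i j
    & H1x (Ay (us 5%N)) i j = rhs (us 4%N) i j /\
      H1y u' i j = Ay (us 5%N) i j - nu * tau / 4 * dy2 (us 4%N) i j].

End Grid.

(* Main.v *)
(* Summation over one period annihilates the central differences [cdiff] and
   [delta2], and preserves the averages [opA], [opB] and [opH1]. Summing each
   stage over the grid therefore removes the diffusion and flux terms; only the
   source of the fourth stage changes the total, and the increments telescope
   in time. *)

Require Import Defs.
From HB Require Import structures.
From mathcomp Require Import all_boot all_order all_algebra.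
From mathcomp Require Import all_classical all_reals all_analysis.
From mathcomp Require Import ring.

Set Implicit Arguments.
Unset Strict Implicit.

Import Order.TTheory GRing.Theory Num.Theory.
Import numFieldNormedType.Exports.

Local Open Scope ring_scope.

(** * One-dimensional sums over a period *)

Section PeriodSum.
Variables (R : realType) (N : nat).
Implicit Types w : int -> R.

Definition periodic w := forall i : int, w (i + N%:Z) = w i.

Definition period_sum w : R := \sum_(1 <= i < N.+1) w i%:Z.

(** A common form for all operators of the scheme: [c] is 0 for differences and 1 for averages.
    Composing operators in the two directions then amounts to multiplying their constants. *)
Definition scales_period_sum (P : (int -> R) -> int -> R) (c : R) :=
  forall w, periodic w -> period_sum (P w) = c * period_sum w.

(** The difference of the two sums telescopes to [w (N + 1) - w 1], which periodicity makes zero. *)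
Lemma period_sum_shift w :
  periodic w -> period_sum (fun i => w (i + 1)) = period_sum w.
Proof.
move=> wP; apply/eqP; rewrite -subr_eq0 /period_sum -sumrB.
under eq_bigr => i _ do rewrite -PoszD addn1.
by rewrite (telescope_sumr (fun i : nat => w i%:Z)) // -add1n PoszD wP subrr.
Qed.

Lemma period_sum_shiftN w :
  periodic w -> period_sum (fun i => w (i - 1)) = period_sum w.
Proof.
(* The forward shift is applied to the function already shifted backward, so that the two shifts
   cancel. *)
move=> wP; rewrite -period_sum_shift => [|i]; last by rewrite addrAC wP.
by apply: eq_bigr => i _; rewrite addrK.
Qed.

Lemma period_sum_cdiff (h : R) : scales_period_sum (cdiff h) 0.
Proof.
move=> w wP; rewrite /period_sum /cdiff -mulr_suml sumrB.
move: (period_sum_shift wP) (period_sum_shiftN wP).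
by rewrite /period_sum => -> ->; rewrite subrr !mul0r.
Qed.

Lemma period_sum_delta2 (h : R) : scales_period_sum (delta2 h) 0.
Proof.
move=> w wP; rewrite /period_sum /delta2 -mulr_suml big_split sumrB -mulr_sumr.
move: (period_sum_shift wP) (period_sum_shiftN wP).
by rewrite /period_sum /= => -> ->; ring.
Qed.

(** Each shift keeps the sum, and the weights 1, 10, 1 add up to 12; for [opB] below, 1, 4, 1 add up
    to 6. *)
Lemma period_sum_opA : scales_period_sum (@opA R) 1.
Proof.
move=> w wP; rewrite /period_sum /opA -mulr_sumr !big_split -mulr_sumr.
move: (period_sum_shift wP) (period_sum_shiftN wP).
by rewrite /period_sum /= => -> ->; field.
Qed.

Lemma period_sum_opB : scales_period_sum (@opB R) 1.
Proof.
move=> w wP; rewrite /period_sum /opB -mulr_sumr !big_split -mulr_sumr.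
move: (period_sum_shift wP) (period_sum_shiftN wP).
by rewrite /period_sum /= => -> ->; field.
Qed.

Lemma period_sum_opH1 (tau nu h : R) : scales_period_sum (opH1 tau nu h) 1.
Proof.
move=> w wP; rewrite /period_sum /opH1 sumrB -[X in _ - X]mulr_sumr.
move: (period_sum_opA wP) (period_sum_delta2 h wP).
by rewrite /period_sum => -> ->; rewrite mul0r mulr0 subr0.
Qed.

End PeriodSum.

(** * Double sums over the periodic grid and the stages of one time step *)

Section GridSum.
Variables (R : realType) (Nx Ny : nat).
Implicit Types v w : grid R.

(** The mesh weight is left out: being constant, it factors out of the inner product with the grid
    function 1. *)
Definition grid_sum v : R :=
  \sum_(1 <= i < Nx.+1) \sum_(1 <= j < Ny.+1) v i%:Z j%:Z.

Lemma inner_one_grid (hx hy : R) v :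
  inner hx hy Nx Ny v (@one_grid R) = hx * hy * grid_sum v.
Proof.
rewrite /inner /grid_sum mulr_sumr; apply: eq_bigr => i _.
by rewrite mulr_sumr; apply: eq_bigr => j _; rewrite mulr1.
Qed.

Lemma eq_grid_sum v w : (forall i j, v i j = w i j) -> grid_sum v = grid_sum w.
Proof. by move=> vw; apply: eq_bigr => i _; apply: eq_bigr => j _. Qed.

Lemma grid_sumD v w :
  grid_sum (fun i j => v i j + w i j) = grid_sum v + grid_sum w.
Proof.
by rewrite /grid_sum -big_split; apply: eq_bigr => i _; rewrite big_split.
Qed.

Lemma grid_sumB v w :
  grid_sum (fun i j => v i j - w i j) = grid_sum v - grid_sum w.
Proof. by rewrite /grid_sum -sumrB; apply: eq_bigr => i _; rewrite sumrB. Qed.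

Lemma grid_sumZ (a : R) v : grid_sum (fun i j => a * v i j) = a * grid_sum v.
Proof.
by rewrite /grid_sum mulr_sumr; apply: eq_bigr => i _; rewrite mulr_sumr.
Qed.

Lemma grid_sum_inx P (c : R) v : scales_period_sum Nx P c ->
  (forall i j, v (i + Nx%:Z) j = v i j) -> grid_sum (inx P v) = c * grid_sum v.
Proof.
move=> Pc vP; rewrite /grid_sum exchange_big [in RHS]exchange_big mulr_sumr.
by apply: eq_bigr => j _; apply: Pc => i.
Qed.

Lemma grid_sum_iny P (c : R) v : scales_period_sum Ny P c ->
  (forall i j, v i (j + Ny%:Z) = v i j) -> grid_sum (iny P v) = c * grid_sum v.
Proof.
move=> Pc vP; rewrite /grid_sum mulr_sumr.
by apply: eq_bigr => i _; apply: Pc => j.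
Qed.

Lemma grid_sum_inx_iny P Q (c d : R) v :
  scales_period_sum Nx P c -> scales_period_sum Ny Q d ->
  periodic_grid Nx Ny v -> grid_sum (inx P (iny Q v)) = c * d * grid_sum v.
Proof.
move=> Pc Qd vP; rewrite (grid_sum_inx Pc) => [|i j].
  by rewrite (grid_sum_iny Qd) ?mulrA // => i j; case: (vP i j).
(* [Q] is an arbitrary operator on functions, so periodicity of [iny Q v] in the first index comes
   from equality of the whole functions [v (i + Nx)] and [v i]. *)
by rewrite /iny (_ : v (i + Nx%:Z) = v i) //; apply/funext => k; case: (vP i k).
Qed.

Lemma grid_sum_iny_inx P Q (c d : R) v :
  scales_period_sum Nx P c -> scales_period_sum Ny Q d ->
  periodic_grid Nx Ny v -> grid_sum (iny Q (inx P v)) = d * c * grid_sum v.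
Proof.
move=> Pc Qd vP; rewrite (grid_sum_iny Qd) => [|i j].
  by rewrite (grid_sum_inx Pc) ?mulrA // => i j; case: (vP i j).
rewrite /inx (_ : v^~ (j + Ny%:Z) = v^~ j) //.
by apply/funext => k; case: (vP k j).
Qed.

Lemma periodic_comp_grid (f : R -> R) v :
  periodic_grid Nx Ny v -> periodic_grid Nx Ny (comp_grid f v).
Proof. by move=> vP i j; rewrite /comp_grid; case: (vP i j) => -> ->. Qed.

Lemma periodic_add_grid v w : periodic_grid Nx Ny v -> periodic_grid Nx Ny w ->
  periodic_grid Nx Ny (add_grid v w).
Proof.
move=> vP wP i j; rewrite /add_grid.
by case: (vP i j) (wP i j) => -> -> [-> ->].
Qed.

(** One ADI half step with intermediate stage [w]. Every term with a [delta2] has constant 0 and all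
    others have constant 1, so the first equation equates the sums of [w] and [v], the second those
    of [v'] and [w]. *)
Lemma grid_sum_diffusion (nu tau hx hy : R) v w v' :
    periodic_grid Nx Ny v -> periodic_grid Nx Ny w -> periodic_grid Nx Ny v' ->
    (forall i j,
      inx (opH1 tau nu hx) (iny (@opA R) w) i j =
      inx (@opA R) (iny (@opA R) v) i j
      + nu * tau / 4 * iny (@opA R) (inx (delta2 hx) v) i j
      + nu * tau / 2 * inx (@opA R) (iny (delta2 hy) v) i j) ->
    (forall i j,
      iny (opH1 tau nu hy) v' i j =
      iny (@opA R) w i j - nu * tau / 4 * iny (delta2 hy) v i j) ->
  grid_sum v' = grid_sum v.
Proof.
have lin3 v0 v1 v2 v3 (a b : R) :
    (forall i j, v0 i j = v1 i j + a * v2 i j + b * v3 i j) ->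
    grid_sum v0 = grid_sum v1 + a * grid_sum v2 + b * grid_sum v3.
  by move/eq_grid_sum ->; rewrite !grid_sumD !grid_sumZ.
have lin2 v0 v1 v2 (a : R) : (forall i j, v0 i j = v1 i j - a * v2 i j) ->
    grid_sum v0 = grid_sum v1 - a * grid_sum v2.
  by move/eq_grid_sum ->; rewrite grid_sumB grid_sumZ.
(* The two pointwise equations become equations between sums, to be evaluated term by term. *)
move=> vP wP v'P /lin3 + /lin2.
have A := period_sum_opA; have d2 := period_sum_delta2.
have H1 := period_sum_opH1.
rewrite (grid_sum_inx_iny (H1 _ _ _ _ _) (A _ _) wP).
rewrite (grid_sum_inx_iny (A _ _) (A _ _) vP).
rewrite (grid_sum_iny_inx (d2 _ _ _) (A _ _) vP).
rewrite (grid_sum_inx_iny (A _ _) (d2 _ _ _) vP).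
rewrite (grid_sum_iny (H1 _ _ _ _ _)); last by move=> i j; case: (v'P i j).
rewrite (grid_sum_iny (A _ _)); last by move=> i j; case: (wP i j).
rewrite (grid_sum_iny (d2 _ _ _)); last by move=> i j; case: (vP i j).
by rewrite !mulr1 !mulr0 !mul0r !mulr0 !addr0 subr0 !mul1r => -> ->.
Qed.

(** The central difference of any periodic flux sums to zero, so [F] and [G] can be arbitrary
    periodic grid functions, whatever nonlinearity produced them. *)
Lemma grid_sum_convection (tau hx hy : R) v v' F G Q :
    periodic_grid Nx Ny v -> periodic_grid Nx Ny v' -> periodic_grid Nx Ny F ->
    periodic_grid Nx Ny G -> periodic_grid Nx Ny Q ->
    (forall i j,
      inx (@opB R) (iny (@opB R) v') i j =
      inx (@opB R) (iny (@opB R) v) i j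
      - tau * iny (@opB R) (inx (cdiff hx) F) i j
      - tau * inx (@opB R) (iny (cdiff hy) G) i j
      + tau * inx (@opB R) (iny (@opB R) Q) i j) ->
  grid_sum v' = grid_sum v + tau * grid_sum Q.
Proof.
have lin4 v0 v1 v2 v3 v4 (a b c : R) :
    (forall i j, v0 i j = v1 i j - a * v2 i j - b * v3 i j + c * v4 i j) ->
    grid_sum v0 = grid_sum v1 - a * grid_sum v2 - b * grid_sum v3
                  + c * grid_sum v4.
  by move/eq_grid_sum ->; rewrite grid_sumD !grid_sumB !grid_sumZ.
move=> vP v'P FP GP QP /lin4.
have B := period_sum_opB; have D := period_sum_cdiff.
rewrite (grid_sum_inx_iny (B _ _) (B _ _) v'P).
rewrite (grid_sum_inx_iny (B _ _) (B _ _) vP).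
rewrite (grid_sum_iny_inx (D _ _ _) (B _ _) FP).
rewrite (grid_sum_inx_iny (B _ _) (D _ _ _) GP).
rewrite (grid_sum_inx_iny (B _ _) (B _ _) QP).
by rewrite !mulr0 !mul0r !mulr0 !subr0 !mul1r.
Qed.

Lemma grid_sum_step (nu tau hx hy : R) (f g : R -> R) S0 S1 u us u' :
    periodic_grid Nx Ny S0 -> periodic_grid Nx Ny S1 ->
    periodic_grid Nx Ny u -> periodic_grid Nx Ny u' ->
    (forall s : nat, (1 <= s <= 5)%N -> periodic_grid Nx Ny (us s)) ->
    strang_adi_hoc_step nu tau hx hy f g S0 S1 u us u' ->
  grid_sum u' = grid_sum u + tau / 2 * grid_sum (add_grid S0 S1).
Proof.
move=> S0P S1P uP u'P usP step.
(* The step is a chain of conserved sums: diffusion from [u] to [us 2], convection from [us 2]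
   straight to [us 4], diffusion from [us 4] to [u']. *)
have us2 : grid_sum (us 2%N) = grid_sum u.
  by apply: (@grid_sum_diffusion nu tau hx hy _ (us 1%N)) => //;
    [exact: usP | exact: usP | |] => i j; case: (step i j).
have u'4 : grid_sum u' = grid_sum (us 4%N).
  by apply: (@grid_sum_diffusion nu tau hx hy _ (us 5%N)) => //;
    [exact: usP | exact: usP | |] => i j; case: (step i j) => _ _ _ _ [].
rewrite u'4 -us2.
(* Stage 4 has the shape of this lemma with time step [tau / 2], and with the sums of the stage 2
   and stage 3 fluxes as [F] and [G]. *)
apply: (@grid_sum_convection _ hx hy _ _
    (add_grid (comp_grid f (us 2%N)) (comp_grid f (us 3%N)))
    (add_grid (comp_grid g (us 2%N)) (comp_grid g (us 3%N)))).
- exact: usP.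
- exact: usP.
- by apply: periodic_add_grid; apply/periodic_comp_grid/usP.
- by apply: periodic_add_grid; apply/periodic_comp_grid/usP.
- exact: periodic_add_grid.
- by move=> i j; case: (step i j).
Qed.

(** Moving by [N] nodes of spacing [L / N] is a translation by [L] when [N] is nonzero. Periodicity
    is asked at the single time [k * tau], since the source is assumed periodic only for times in
    [[0, T]]. *)
Lemma periodic_sample (S : R -> R -> R -> R) (L tau : R) (k : nat) :
    (0 < Nx)%N -> (0 < Ny)%N ->
    (forall x y, S (x + L) y (k%:R * tau) = S x y (k%:R * tau) /\
                 S x (y + L) (k%:R * tau) = S x y (k%:R * tau)) ->
  periodic_grid Nx Ny (sample S tau (L / Nx%:R) (L / Ny%:R) k).
Proof.
move=> Nx0 Ny0 SP i j.
have shift (N : nat) (m : int) : (0 < N)%N ->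
    (m + N%:Z)%:~R * (L / N%:R) = m%:~R * (L / N%:R) + L.
  move=> N0; rewrite intrD mulrDl -pmulrn (mulrC N%:R) divfK //.
  by rewrite pnatr_eq0 -lt0n.
by rewrite /sample !shift //; apply: SP.
Qed.

End GridSum.

(** * Accumulation of the source over the time levels *)

Theorem theorem3 (R : realType) (L T nu : R) (f g : R -> R)
    (S : R -> R -> R -> R) (Nt Nx Ny : nat)
    (u : nat -> grid R) (us : nat -> nat -> grid R) :
  let tau := T / Nt%:R in
  let hx := L / Nx%:R in
  let hy := L / Ny%:R in
  let Sg := sample S tau hx hy in
  0 < L -> 0 < T -> 0 < nu ->
  (0 < Nt)%N -> (3 <= Nx)%N -> (3 <= Ny)%N ->
  smooth (V := R^o) f -> smooth (V := R^o) g ->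
  smooth_on (V := (R^o * R^o * R^o)%type)
    (fun p => 0 <= p.2 <= T) (fun p => S p.1.1 p.1.2 p.2) ->
  (forall x y t : R, 0 <= t <= T ->
     S (x + L) y t = S x y t /\ S x (y + L) t = S x y t) ->
  (forall n : nat, (n <= Nt)%N -> periodic_grid Nx Ny (u n)) ->
  (forall n s : nat, (n < Nt)%N -> (1 <= s <= 5)%N ->
     periodic_grid Nx Ny (us n s)) ->
  (forall n : nat, (n < Nt)%N ->
     strang_adi_hoc_step nu tau hx hy f g (Sg n) (Sg n.+1)
       (u n) (us n) (u n.+1)) ->
  forall n : nat, (n < Nt)%N ->
    inner hx hy Nx Ny (u n.+1) (@one_grid R) =
    inner hx hy Nx Ny (u 0%N) (@one_grid R) +
    tau / 2 * \sum_(0 <= k < n.+1)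
      inner hx hy Nx Ny (add_grid (Sg k) (Sg k.+1)) (@one_grid R).
Proof.
move=> tau hx hy Sg L0 T0 nu0 Nt0 Nx3 Ny3 _ _ _ SP uP usP step n nNt.
have SgP k : (k <= Nt)%N -> periodic_grid Nx Ny (Sg k).
  move=> kNt; apply: periodic_sample => [||x y].
  - exact: leq_trans _ Nx3.
  - exact: leq_trans _ Ny3.
  (* The sampling time [k * T / Nt] lies in [[0, T]] because [k <= Nt]; the level [Nt] itself is
     included, as the last step samples it. *)
  - apply: SP; rewrite /tau mulr_ge0 ?ler0n ?divr_ge0 ?(ltW T0) //=.
    by rewrite mulrCA ler_piMr ?(ltW T0) // ler_pdivrMr ?ltr0n // mul1r ler_nat.
have increment k : (k < Nt)%N -> inner hx hy Nx Ny (u k.+1) (@one_grid R) =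
    inner hx hy Nx Ny (u k) (@one_grid R) + tau / 2 *
      inner hx hy Nx Ny (add_grid (Sg k) (Sg k.+1)) (@one_grid R).
  move=> kNt; have kNt' := ltnW kNt.
  rewrite !inner_one_grid (grid_sum_step (SgP _ kNt') (SgP _ kNt) (uP _ kNt')
    (uP _ kNt) (fun s => usP k s kNt) (step _ kNt)).
  by rewrite mulrDr (mulrCA _ (tau / 2)).
(* The sum already has one term at [n = 0], so the base case also uses [increment]. *)
elim: n nNt => [|n IHn] nNt; rewrite increment //; first by rewrite big_nat1.
by rewrite (IHn (ltnW nNt)) [in RHS]big_nat_recr //= mulrDr addrA.
Qed.
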